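(* Suppose $\kappa$ is an infinite regular cardinal and $\lambda=\kappa^+=\mathfrak{b}_\kappa=\operatorname{stick}(\kappa)$. Then $\lambda\kappa\not\longrightarrow(\lambda\kappa,3)^2$.
   Context: $\mathfrak{b}_\kappa$ is the unbounding number at $\kappa$: the least cardinality of a family $U$ of functions from $\kappa$ to $\kappa$ such that no single $g:\kappa\to\kappa$ satisfies, for every $u\in U$, $|\{\iota<\kappa: u(\iota)\geq g(\iota)\}|<\kappa$. Writing $[Y]^\mu$ for the set of subsets of $Y$ of cardinality $\mu$, $\operatorname{stick}(\kappa)$ is the least cardinality of a family $X\subseteq[\kappa^+]^\kappa$ such that for every $y\in[\kappa^+]^{\kappa^+}$ there is $x\in X$ with $x\subseteq y$. $\lambda\kappa$ is the ordinal product: the order type of $\kappa$ many copies of $\lambda$ placed one after another. For linear order types $\tau,\varphi$ and $n<\omega$, $\tau\longrightarrow(\varphi,n)^2$ means: whenever $P$ is a linear order of type $\tau$ and $f:[P]^2\to\{0,1\}$ (where $[P]^2$ is the set of two-element subsets of $P$), either there is a suborder $Q\subseteq P$ of type $\varphi$ with $f$ constantly $0$ on $[Q]^2$, or there is $Q\subseteq P$ with $n$ elements with $f$ constantly $1$ on $[Q]^2$; $\not\longrightarrow$ is its negation. *)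

(* Defs.v *)
From mathcomp Require Import all_boot all_order.
From mathcomp Require Import boolp classical_sets functions cardinality.
From mathcomp Require wochoice.

Set Implicit Arguments.
Unset Strict Implicit.
Unset Printing Implicit Defensive.

Local Open Scope order_scope.
Local Open Scope classical_set_scope.
Local Open Scope card_scope.

Definition card_lt {T U : Type} (A : set T) (B : set U) : Prop :=
  A #<= B /\ ~ (B #<= A).

Notation "A '#<' B" := (card_lt A B)
  (at level 79, format "A  '#<'  B") : card_scope.

(* A cardinal is represented by an initial ordinal: a well-ordered type none of
   whose proper initial segments has the cardinality of the whole. *)
Definition initial_ordinal {d} (K : orderType d) : Prop :=
  wochoice.well_order (<=%O : rel K) /\
  forall x : K, [set y | y < x] #< [set: K].

Definition infinite_cardinal {d} (K : orderType d) : Prop :=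
  initial_ordinal K /\ infinite_set [set: K].

Definition cofinal {d} {K : orderType d} (A : set K) : Prop :=
  forall x, exists2 y, A y & x <= y.

Definition infinite_regular_cardinal {d} (K : orderType d) : Prop :=
  infinite_cardinal K /\ forall A : set K, cofinal A -> [set: K] #<= A.

Definition successor_cardinal {dK dL} (K : orderType dK) (L : orderType dL) :
    Prop :=
  [/\ initial_ordinal L, [set: K] #< [set: L] &
      forall (T : Type) (A : set T), [set: K] #< A -> [set: L] #<= A].

Definition least_card {T : Type} (F : set (set T)) (M : Type) : Prop :=
  (exists2 X, F X & X #= [set: M]) /\ (forall X, F X -> [set: M] #<= X).

(* [Y]^mu, where the cardinal mu is that of the set B *)
Definition subsets_of_card {T U : Type} (Y : set T) (B : set U) : set (set T) :=
  [set A | A `<=` Y /\ A #= B].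

Definition unbounded_family {d} (K : orderType d) : set (set (K -> K)) :=
  [set U | ~ exists g : K -> K,
             forall u, U u -> [set i | g i <= u i] #< [set: K]].

Definition is_unbounding_number {d} (K : orderType d) (M : Type) : Prop :=
  least_card (@unbounded_family d K) M.

(* S plays the role of kappa^+ *)
Definition stick_family (K S : Type) : set (set (set S)) :=
  [set X | X `<=` subsets_of_card [set: S] [set: K] /\
           forall y, subsets_of_card [set: S] [set: S] y ->
             exists2 x, X x & x `<=` y].

Definition is_stick {d} (K : orderType d) (M : Type) : Prop :=
  exists dS (S : orderType dS),
    successor_cardinal K S /\ least_card (@stick_family K S) M.

Definition has_order_type {dP dT} {P : orderType dP} (Q : set P)
    (T : orderType dT) : Prop :=
  exists2 e : T -> P, set_bij [set: T] Q e & {mono e : x y / x <= y}.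

Definition homogeneous {P : Type} (f : set P -> bool) (c : bool) (Q : set P) :
    Prop :=
  forall a, subsets_of_card Q `I_2 a -> f a = c.

(* tau --> (phi, n)^2 for the order types of T and F. A colouring of [P]^2 is a
   total function on subsets of P, whose values off [P]^2 are never used. *)
Definition arrows {dT dF} (T : orderType dT) (F : orderType dF) (n : nat) :
    Prop :=
  forall dP (P : orderType dP), has_order_type [set: P] T ->
  forall f : set P -> bool,
    (exists2 Q : set P, has_order_type Q F & homogeneous f false Q) \/
    (exists2 Q : set P, Q #= `I_n & homogeneous f true Q).

(* The ordinal product of L and K, K many copies of L: the comparison in K comes
   first. *)
Definition ord_mul {dL dK} (L : orderType dL) (K : orderType dK) : orderType _ :=
  (K *l L)%type.

(* Main.v *)
(* Realise lambda kappa as kappa columns of length lambda.  A subset of order type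
   lambda kappa meets not fewer than kappa columns in lambda points, so a
   triangle-free graph in which any such subset spans an edge is enough.
   The point (c0, a) is joined to (c, b) in a later column when b lies in a set
   N_a(c) of b's below a, of size < kappa.  Fix a stick (x_g), an unbounded family
   (v_e) and injections of the ordinals d < lambda into kappa, all of them indexed
   by lambda.  N_a(c) must meet x_g whenever x_g is below a and, for some d, e < a
   of code < c in a, the code of g in d is at most v_e(c') for some c' <= c.  These
   are < kappa requirements on sets of size kappa, so N_a(c) can avoid the < kappa
   points of the N_{a'}(c) with a' in N_a(c'), c' < c; hence no triangles.
   If Q has lambda points in kappa columns, pick inside the c-th such column a
   stick set x_{g(c)}.  Some d bounds all g(c), and some v_e is not dominated by the
   codes of the g(c) in d; then any large enough a in an early column of Q is joined
   to a point of x_{g(c)} for some c. *)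
Require Import Defs.
From mathcomp Require Import all_boot all_order.
From mathcomp Require Import boolp classical_sets functions cardinality.
From mathcomp Require wochoice.

Set Implicit Arguments.
Unset Strict Implicit.
Unset Printing Implicit Defensive.

Import Order.TTheory.
Local Open Scope order_scope.
Local Open Scope classical_set_scope.
Local Open Scope card_scope.

(** * Comparison of cardinals and well-founded recursion *)

Lemma set_inj_card_le T U (f : T -> U) (A : set T) (B : set U) :
  set_inj A f -> (forall x, A x -> B (f x)) -> A #<= B.
Proof.
move=> finj fAB; apply: (@card_le_trans _ _ _ (f @` A)).
  by move: (inj_card_eq finj); rewrite card_eq_le => /andP[].
by apply: subset_card_le => _ [x Ax <-]; apply: fAB.
Qed.

Lemma card_le_set_inj T U (u0 : U) (A : set T) (B : set U) :
  A #<= B -> exists2 f : T -> U, set_inj A f & forall x, A x -> B (f x).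
Proof.
move=> /card_leP[g].
exists (fun x => if pselect (A x) is left Ax then val (g (SigSub (mem_set Ax)))
                 else u0).
- move=> x y /set_mem Ax /set_mem Ay.
  case: pselect => // Ax'; case: pselect => // Ay' /val_inj.
  by move=> /(@inj _ _ _ g _ _ (mem_set I) (mem_set I)) /(congr1 val).
- by move=> x Ax; case: pselect => // Ax'; apply: set_valP.
Qed.

Lemma card_leT_inj T U (B : set U) :
  [set: T] #<= B -> exists2 f : T -> U, injective f & forall x, B (f x).
Proof.
move=> /[dup] leTB /card_leP[g].
have [[x0 _]|noT] := pselect ([set: T] !=set0).
  have [f finj fB] := card_le_set_inj (val (g (SigSub (mem_set (I : setT x0))))) leTB.
  by exists f => [x y|x]; [apply: finj; apply: mem_set|apply: fB].
have noT' (x : T) : False by apply: noT; exists x.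
by exists (fun x => False_rect U (noT' x)) => x; case: (noT' x).
Qed.

(** Zorn's lemma on graphs of partial injections from [A] to [B]: a maximal graph has domain [A] or
    range [B], since otherwise a free point of each could be paired. *)
Lemma card_le_total T U (A : set T) (B : set U) : A #<= B \/ B #<= A.
Proof.
have [->|/set0P[u0 Bu0]] := eqVneq B set0; first by right; apply: card_ge0.
have [->|/set0P[t0 At0]] := eqVneq A set0; first by left; apply: card_ge0.
pose P (G : set (T * U)) :=
  (forall p, G p -> A p.1 /\ B p.2) /\
  (forall p q, G p -> G q -> p.1 = q.1 <-> p.2 = q.2).
have [|G [[GAB Ginj] Gmax]] := @Zorn_bigcup _ P.
  move=> F FP Ftot; split=> [p [X FX Xp]|p q [X FX Xp] [Y FY Yq]].
    exact: (FP _ FX).1.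
  have [XY|YX] := Ftot _ _ FX FY.
    by apply: (FP _ FY).2 => //; apply: XY.
  by apply: (FP _ FX).2 => //; apply: YX.
have [domG|/existsNP[t /not_implyP[At ntG]]] :=
    pselect (forall t, A t -> exists u, G (t, u)).
  left; have /choice[f fG] : forall t, exists u, A t -> G (t, u).
    move=> t.
    have [At|nAt] := pselect (A t); last by exists u0.
    by have [u Gtu] := domG t At; exists u.
  apply: (@set_inj_card_le _ _ f) => [x y /set_mem Ax /set_mem Ay fxy|x Ax].
    exact: (Ginj _ _ (fG _ Ax) (fG _ Ay)).2.
  exact: (GAB _ (fG _ Ax)).2.
have [ranG|/existsNP[u /not_implyP[Bu nuG]]] :=
    pselect (forall u, B u -> exists t, G (t, u)).
  right; have /choice[f fG] : forall u, exists t, B u -> G (t, u).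
    move=> u.
    have [Bu|nBu] := pselect (B u); last by exists t0.
    by have [t' Gtu] := ranG u Bu; exists t'.
  apply: (@set_inj_card_le _ _ f) => [x y /set_mem Bx /set_mem By fxy|x Bx].
    exact: (Ginj _ _ (fG _ Bx) (fG _ By)).1.
  exact: (GAB _ (fG _ Bx)).1.
exfalso; apply: (Gmax (G `|` [set (t, u)])).
  split=> [p Gp|sub]; first by left.
  by apply: ntG; exists u; apply: sub; right.
split=> [p [/GAB//|-> //]|p q [Gp|->] [Gq|->] //=].
- exact: Ginj.
- split=> pE; [case: ntG; exists p.2|case: nuG; exists p.1].
    by rewrite -pE -surjective_pairing.
  by rewrite -pE -surjective_pairing.
- split=> pE; [case: ntG; exists q.2|case: nuG; exists q.1].
    by rewrite pE -surjective_pairing.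
  by rewrite pE -surjective_pairing.
Qed.

Lemma well_order_lt_wf {d} (K : orderType d) :
  wochoice.well_order (<=%O : rel K) -> well_founded (fun x y : K => x < y).
Proof.
move=> wo x; apply: contrapT => nAx.
have [|m [[/asboolP mN mmin] _]] := wo [pred y | `[< ~ Acc (fun x y : K => x < y) y >]].
  by exists x; apply/asboolP.
apply: mN; constructor=> y ym; apply: contrapT => nAy.
by have := mmin y (asboolT nAy); rewrite leNgt ym.
Qed.

Lemma lex_wf A B (R : A -> A -> Prop) (S : B -> B -> Prop) :
  well_founded R -> well_founded S ->
  well_founded (fun p q : A * B => R p.1 q.1 \/ p.1 = q.1 /\ S p.2 q.2).
Proof.
move=> wR wS [a b]; elim/(well_founded_ind wR): a b => a IHa b.
elim/(well_founded_ind wS): b => b IHb.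
by constructor=> -[a' b'] [/IHa//|/= [-> /IHb]].
Qed.

(** Locality of [F] lets the recursive call return the default [b0] off the predecessors of [x]. *)
Lemma wf_recursion T B (R : T -> T -> Prop) (F : T -> (T -> B) -> B) (b0 : B) :
  well_founded R ->
  (forall x g h, (forall y, R y x -> g y = h y) -> F x g = F x h) ->
  exists f, forall x, f x = F x f.
Proof.
move=> wR Floc.
pose G x (rec : forall y, R y x -> B) :=
  F x (fun y => if pselect (R y x) is left r then rec y r else b0).
exists (Fix wR (fun=> B) G) => x; rewrite Fix_eq.
  by apply: Floc => y r; case: pselect.
move=> y f g fg; apply: Floc => z r; case: pselect => // r'; exact: fg.
Qed.

(* Cardinals being comparable, this says that [A] has size less than [kappa]. *)
Definition small {d} (K : orderType d) {T} (A : set T) := ~ ([set: K] #<= A).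

(** * Sets of size less than a regular kappa *)

Section Regular.
Context {d : Order.disp_t} {K : orderType d}.
Hypothesis Kreg : infinite_regular_cardinal K.

(** A set without a strict upper bound is cofinal, so regularity makes it as large as [K]. *)
Lemma small_bounded (A : set K) : small K A -> exists b, forall a, A a -> a < b.
Proof.
move=> As; apply: contrapT => nb; apply: As; apply: Kreg.2 => x.
apply: contrapT => nx; apply: nb; exists x => a Aa; rewrite ltNge.
by apply/negP => xa; apply: nx; exists a.
Qed.

Lemma small_sub T (A B : set T) : A `<=` B -> small K B -> small K A.
Proof. by move=> AB sB KA; apply: sB; apply: (card_le_trans KA); apply: subset_card_le. Qed.

Lemma small_lt (b : K) : small K [set a | a < b].
Proof. by have [_] := Kreg.1.1.2 b. Qed.

Lemma bounded_small (b : K) (A : set K) : (forall a, A a -> a < b) -> small K A.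
Proof. by move=> Ab; apply: (small_sub Ab); apply: small_lt. Qed.

Lemma not_small_cofinal (A : set K) : ~ small K A -> forall b, exists2 a, A a & b <= a.
Proof.
move=> nA b; apply: contrapT => nb; apply: nA; apply: (@bounded_small b) => a Aa.
by rewrite ltNge; apply/negP => ba; apply: nb; exists a.
Qed.

Lemma exists_gt (b : K) : exists c, b < c.
Proof.
have [|c cb] := @small_bounded [set b]; last by exists c; apply: cb.
by move=> Kb; apply: Kreg.1.2; apply: card_le_finite Kb (finite_set1 b).
Qed.

Lemma small_le (b : K) : small K [set a | a <= b].
Proof.
have [c bc] := exists_gt b; apply: (@bounded_small c) => a /= ab.
exact: le_lt_trans bc.
Qed.

Lemma small_image T U (f : T -> U) (A : set T) : small K A -> small K (f @` A).
Proof. by move=> As /card_le_trans Kf; apply: As; apply: Kf; apply: card_image_le. Qed.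

Lemma small_set_inj T (f : T -> K) (A : set T) (b : K) :
  set_inj A f -> (forall x, A x -> f x < b) -> small K A.
Proof.
move=> finj fb KA; apply: (@small_lt b); apply: (card_le_trans KA).
exact: set_inj_card_le finj fb.
Qed.

(* An injection [g] of [kappa] into the union would cover [kappa] by few bounded
   sets, whose bounds are bounded by regularity; this avoids cardinal products. *)
Lemma small_bigcup T J (I : set J) (A : J -> set T) :
  small K I -> (forall i, I i -> small K (A i)) -> small K (\bigcup_(i in I) A i).
Proof.
move=> Is As /card_leT_inj[g ginj gA].
have /choice[b bP] : forall i, exists b, I i -> forall k, A i (g k) -> k < b.
  move=> i.
  have [Ii|nIi] := pselect (I i).
    have [|b bP] := @small_bounded (g @^-1` A i).
      move=> KA; apply: (As i Ii); apply: (card_le_trans KA).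
      by apply: (@set_inj_card_le _ _ g) => // x y _ _; apply: ginj.
    by exists b.
  have /infinite_setN0[k0 _] := Kreg.1.2; by exists k0.
have [m mP] := small_bounded (small_image (f := b) Is).
have [i Ii Ai] := gA m.
have := mP (b i) (imageP _ Ii); rewrite ltNge => /negP; apply.
exact/ltW/bP.
Qed.

Lemma small_setU T (A B : set T) : small K A -> small K B -> small K (A `|` B).
Proof.
move=> sA sB.
apply: (@small_sub _ _ (\bigcup_(b in [set: bool]) if b then A else B)).
  by move=> x [Ax|Bx]; [exists true|exists false].
apply: small_bigcup => [Kbool|[] _ //].
by apply: Kreg.1.2; apply: card_le_finite Kbool finite_finset.
Qed.
End Regular.

Lemma card_eqT_enum M T (X : set T) : [set: M] #= X ->
  exists f : M -> T,
    [/\ injective f, forall m, X (f m) & forall x, X x -> exists m, f m = x].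
Proof.
move=> /card_eqP[g]; exists (fun m => val (g (SigSub (mem_set (I : setT m))))).
split=> [m n /val_inj/(@inj _ _ _ g _ _ (mem_set I) (mem_set I))/(congr1 val)//|m|x Xx].
  exact: set_valP.
have [[m mT] _ gm] := @surj _ _ _ _ g (SigSub (mem_set Xx)) I.
by exists m; rewrite -[RHS]/(val (SigSub (mem_set Xx))) -gm; congr (val (g _)); apply: val_inj.
Qed.

(** * The successor lambda: regularity, codes for segments, stick sequence *)

Section Successor.
Context {dK dL : Order.disp_t} {K : orderType dK} {L : orderType dL}.
Hypothesis Kreg : infinite_regular_cardinal K.
Hypothesis Lsucc : successor_cardinal K L.
Hypothesis Lunb : is_unbounding_number K L.

Lemma card_le_of_not_ge T (C : set T) : ~ ([set: L] #<= C) -> C #<= [set: K].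
Proof.
move=> nLC; have [//|KC] := card_le_total C [set: K].
by apply: contrapT => nCK; apply: nLC; have [_ _] := Lsucc; apply.
Qed.

Lemma segment_not_ge (x : L) : ~ ([set: L] #<= [set y | y < x]).
Proof. by have [[_ /(_ x)[]]] := Lsucc. Qed.

Lemma family_dominated (U : set (K -> K)) : ~ ([set: L] #<= U) ->
  exists g, forall u, U u -> small K [set i | g i <= u i].
Proof.
move=> nLU; apply: contrapT => ng; apply: nLU; apply: Lunb.2 => -[g gU].
by apply: ng; exists g => u /gU[].
Qed.

Lemma unbounded_sequence : exists v : L -> K -> K,
  forall g, exists a, ~ small K [set i | g i <= v a i].
Proof.
have [[X Xunb XL] _] := Lunb.
have [v [_ vX Xv]] := card_eqT_enum (card_esym XL).
exists v => g; apply: contrapT => na; apply: Xunb; exists g => _ /Xv[a <-].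
by split; [exact: card_leT|move=> ?; apply: na; exists a; apply].
Qed.

(* The regularity of [kappa^+] is derived from [b_kappa = kappa^+]: a cofinal map
   from [K] would split an unbounded family into [kappa] dominated pieces, whose
   dominating functions would again be dominated. *)
Lemma bounded_of_card_le (c : K -> L) : exists b, forall k, c k < b.
Proof.
apply: contrapT => nb.
have cof a : exists k, a <= c k.
  apply: contrapT => nk; apply: nb; exists a => k; rewrite ltNge.
  by apply/negP => ack; apply: nk; exists k.
have [v vunb] := unbounded_sequence.
have /choice[g gP] a : exists g, forall a', a' <= a -> small K [set i | g i <= v a' i].
  have [|g gP] := @family_dominated (v @` [set a' | a' < a]).
    by move=> /card_le_trans/(_ (card_image_le _ _))/segment_not_ge.
  (* [g] dominates [v a'] only for a' below [a]; raising it strictly above [v a] covers a' = a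
     too. *)
  have /choice[h hP] i : exists k, g i <= k /\ v a i < k.
    have [k kP] := exists_gt Kreg (Order.max (g i) (v a i)).
    by exists k; move: kP; rewrite gt_max => /andP[/ltW].
  exists h => a'; rewrite le_eqVlt => /orP[/eqP->|a'a].
    apply: (@small_sub _ _ _ _ set0) => [i /=|KA].
      by rewrite leNgt (hP i).2.
    have /infinite_setN0[k0 _] := Kreg.1.2.
    by have [f _ /(_ k0)] := card_leT_inj KA.
  have gs := gP (v a') (ex_intro2 _ _ a' a'a erefl).
  apply: small_sub gs => i /=; exact/le_trans/(hP i).1.
have [|h hP] := @family_dominated [set g (c k) | k in [set: K]].
  move=> /card_le_trans/(_ (card_image_le _ _)) LK.
  by have [_ [_ /(_ LK)]] := Lsucc.
have [a] := vunb h; apply.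
have [k ack] := cof a.
have hs := hP _ (ex_intro2 _ _ k I erefl).
apply: small_sub (small_setU Kreg hs (gP (c k) a ack)).
move=> i /= hv; have [hg|gh] := leP (h i) (g (c k) i); [by left|right => /=].
exact: le_trans (ltW gh) hv.
Qed.

Lemma exists_gt_succ (a : L) : exists b, a < b.
Proof.
have /infinite_setN0[k0 _] := Kreg.1.2.
by have [b /(_ k0)] := bounded_of_card_le (fun=> a); exists b.
Qed.

Lemma card_ge_unbounded (C : set L) (a : L) : [set: L] #<= C ->
  exists2 b, C b & a < b.
Proof.
move=> LC; apply: contrapT => nb; have [a' aa'] := exists_gt_succ a.
apply: (@segment_not_ge a'); apply: (card_le_trans LC); apply: subset_card_le => b Cb /=.
by apply: le_lt_trans aa'; rewrite leNgt; apply/negP => ab; apply: nb; exists b.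
Qed.

(** A smaller [C] injects into kappa; inverting the injection lists [C] along kappa, and such a list
    is bounded. *)
Lemma unbounded_card_ge (C : set L) : (forall a, exists2 b, C b & a <= b) ->
  [set: L] #<= C.
Proof.
have /infinite_setN0[k0 _] := Kreg.1.2.
move=> Cunb; apply: contrapT => /card_le_of_not_ge /(card_le_set_inj k0)[f finj _].
have [l0 _] : exists l0 : L, True.
  by have [_ [/card_leT_inj[h _ _] _] _] := Lsucc; exists (h k0).
have /choice[c cP] k : exists l, forall b, C b -> f b = k -> b = l.
  have [[l [Cl fl]]|nl] := pselect (exists l, C l /\ f l = k).
    by exists l => b Cb fb; apply: finj; rewrite ?inE // fl.
  by exists l0 => b Cb fb; case: nl; exists b.
have [a aP] := bounded_of_card_le c.
have [b Cb ab] := Cunb a.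
by have := aP (f b); rewrite -(cP _ _ Cb erefl) ltNge ab.
Qed.

Lemma segment_injection (a : L) : exists f : L -> K, set_inj [set b | b < a] f.
Proof.
have /infinite_setN0[k0 _] := Kreg.1.2.
have /card_le_of_not_ge/(card_le_set_inj k0)[f finj _] := @segment_not_ge a.
by exists f.
Qed.

(** The stick family lives on some copy [S] of kappa^+. Minimality of both successors gives a
    bijection from [S] to [L], which carries the family over. *)
Lemma stick_sequence : is_stick K L -> exists x : L -> set L,
  (forall a, [set: K] #= x a) /\
  forall C, [set: L] #<= C -> exists a, x a `<=` C.
Proof.
move=> [dS [S [[_ KS Smin] [[X [Xsub Xstick] XL] _]]]].
have [_ KL Lmin] := Lsucc.
have LS : [set: S] #= [set: L] by rewrite card_eq_le Smin ?Lmin.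
have [f [finj _ fsurj]] := card_eqT_enum LS.
have [y [_ yX Xy]] := card_eqT_enum (card_esym XL).
exists (fun a => f @` y a); split=> [a|C LC].
  apply: card_esym; apply: (card_eq_trans (inj_card_eq (in2W finj))).
  by have [] := Xsub _ (yX a).
have [|x] := Xstick (f @^-1` C).
  split=> //; rewrite card_eq_le card_leT /=; apply: (card_le_trans (Smin _ _ KL)).
  apply: (card_le_trans LC).
  have /choice[g gP] c : exists s, f s = c by apply: fsurj.
  apply: (@set_inj_card_le _ _ g) => [c e _ _ gce|c Cc /=]; last by rewrite gP.
  by rewrite -(gP c) gce gP.
by move=> /Xy[a <-] ayC; exists a => _ [s /ayC ? <-].
Qed.

Lemma bounded_of_card_eq (x : set L) : [set: K] #= x -> exists b, forall a, x a -> a < b.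
Proof.
move=> /card_eqT_enum[f [_ _ xf]]; have [b fb] := bounded_of_card_le f.
by exists b => _ /xf[k <-].
Qed.
End Successor.

(** * Construction of the sparse sets N_a(c) *)

Section Graph.
Context {dK dL : Order.disp_t} {K : orderType dK} {L : orderType dL}.
Hypothesis Kreg : infinite_regular_cardinal K.
Hypothesis Lwf : well_founded (fun a b : L => a < b).
Variables (code : L -> L -> K) (v : L -> K -> K) (x : L -> set L).
Hypothesis code_inj : forall a, set_inj [set b | b < a] (code a).
Hypothesis x_large : forall a, [set: K] #= x a.

(** As [c] grows, these sets of size less than kappa exhaust the predecessors of [a]. *)
Definition early (a : L) (c : K) : set L := [set d | d < a /\ code a d < c].

(* The indices of the stick sets that [N_a(c)] has to meet. *)
Definition task (a : L) (c : K) : set L :=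
  \bigcup_(d in early a c) \bigcup_(e in early a c) \bigcup_(c' in [set c' | c' <= c])
    [set g | g < d /\ code d g <= v e c'].

Lemma small_early a c : small K (early a c).
Proof.
apply: (@small_set_inj _ _ Kreg _ (code a) _ c) => [y z|y []//].
by move=> /set_mem[ya _] /set_mem[za _]; apply: code_inj; apply: mem_set.
Qed.

Lemma small_task a c : small K (task a c).
Proof.
apply: (small_bigcup Kreg) => [|d _]; first exact: small_early.
apply: (small_bigcup Kreg) => [|e _]; first exact: small_early.
apply: (small_bigcup Kreg) => [|c' _]; first exact: small_le.
have [m vm] := exists_gt Kreg (v e c').
apply: (@small_set_inj _ _ Kreg _ (code d) _ m) => [y z|y [_ /le_lt_trans->//]].
by move=> /set_mem[yd _] /set_mem[zd _]; apply: code_inj; apply: mem_set.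
Qed.

(** Recursion on the pairs (a, c) in lexicographic order: what N_a(c) must avoid depends on N_a(c')
    for c' < c and on N_{a'}(c) for a' < a. One point is picked per task. *)
Lemma sparse_family : exists N : L -> K -> set L,
  (forall a a' b c c', c' < c -> N a c' a' -> N a c b -> ~ N a' c b) /\
  (forall a c g, task a c g -> x g `<=` [set b | b < a] ->
     exists2 b, N a c b & x g b).
Proof.
(* Restricting to a' < a keeps the recursion local. No a' in N_a(c') is lost, since only stick sets
   below [a] are served. *)
pose forbidden (M : L * K -> set L) p : set L :=
  \bigcup_(c' in [set c' | c' < p.2]) \bigcup_(a' in M (p.1, c') `&` [set a' | a' < p.1])
    M (a', p.2).
have [noL|l0] := pselectT L.
  by exists (fun _ _ => set0); split=> a; case: (noL a).
(* The default [l0] is never taken: [x g] has size kappa and the forbidden set is smaller. *)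
pose pick M p g := xget l0 (x g `\` forbidden M p).
have [|p M1 M2 M12|M ME] := @wf_recursion _ (set L)
    (fun q p : L * K => q.1 < p.1 \/ q.1 = p.1 /\ q.2 < p.2)
    (fun p M => [set pick M p g | g in task p.1 p.2 `&` [set g | x g `<=` [set b | b < p.1]]])
    set0.
- by have [[wo _] _] := Kreg.1; exact: lex_wf Lwf (well_order_lt_wf wo).
- have F12 : forbidden M1 p = forbidden M2 p.
    apply: eq_bigcupr => c' /= c'p; rewrite (M12 (p.1, c')); last by right.
    by apply: eq_bigcupr => a' /= [_ a'p]; rewrite (M12 (a', p.2)) //; left.
  by rewrite /pick F12.
have Msmall p : small K (M p).
  by rewrite ME; apply: small_image; apply: small_sub (@small_task p.1 p.2) => g [].
have pickP p g : (x g `\` forbidden M p) (pick M p g).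
  apply: xgetPex; apply: contrapT => nx.
  have : small K (forbidden M p).
    apply: (small_bigcup Kreg) => [|c' _]; first exact: small_lt.
    apply: (small_bigcup Kreg) => //.
    by apply: small_sub (@Msmall (p.1, c')) => a' [].
  apply; have := x_large g; rewrite card_eq_le => /andP[Kx _].
  apply: (card_le_trans Kx); apply: subset_card_le => b xb.
  by apply: contrapT => nb; apply: nx; exists b.
have pickM a c b : M (a, c) b -> b < a /\ ~ forbidden M (a, c) b.
  rewrite ME => -[g [_ xa] <-]; have [xp np] := pickP (a, c) g.
  by split=> //; apply: xa.
exists (fun a c => M (a, c)); split=> [a a' b c c' cc' Na' Nb Nab|a c g tg xa].
  have [_] := pickM _ _ _ Nb; apply; exists c' => //; exists a' => //.
  by split=> //; have [] := pickM _ _ _ Na'.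
have [xp _] := pickP (a, c) g.
by exists (pick M (a, c) g) => //; rewrite ME; exists g.
Qed.
End Graph.

(** * The graph on the columns and its homogeneous sets *)

Lemma card_set2 T (p q : T) : p <> q -> [set p; q] #= `I_2.
Proof.
move=> pq; pose g (n : nat) := if n is 0%N then p else q.
rewrite -(_ : g @` `I_2 = [set p; q]).
  apply: inj_card_eq => m n; rewrite !inE /=.
  by case: m n => [|[|//]] [|[|//]] //= _ _ qp; case: pq.
apply/seteqP; split=> [_ [[|n] _ <-]|r [->|->]]; [by left|by right| |].
  by exists 0%N.
by exists 1%N.
Qed.

Section Coloring.
Context {dK dL : Order.disp_t} {K : orderType dK} {L : orderType dL}.

Definition edge (N : L -> K -> set L) (p q : K * L) : Prop :=
  p.1 < q.1 /\ N p.2 q.1 q.2.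

(** Edges point to later columns, so a triangle cannot be cyclic. It has the form p to q, q to r, p
    to r, which the sparsity hypothesis excludes. *)
Lemma no_homogeneous_triple (N : L -> K -> set L) (Q : set (K * L)) :
  (forall a a' b c c', c' < c -> N a c' a' -> N a c b -> ~ N a' c b) ->
  ~ (Q #= `I_3 /\
     homogeneous (fun a => `[< exists p q, [/\ a p, a q & edge N p q] >]) true Q).
Proof.
move=> Ntri [Q3 Qhom].
have [f [finj fQ _]] : exists f : 'I_3 -> _, [/\ injective f, forall m, Q (f m)
    & forall x, Q x -> exists m, f m = x].
  apply: card_eqT_enum; apply: card_eq_trans (card_esym Q3).
  exact: card_esym card_II.
have adj i j : i != j -> edge N (f i) (f j) \/ edge N (f j) (f i).
  move=> ij; have fij : f i <> f j by move/finj/eqP; apply/negP.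
  have : `[< exists p q, [/\ [set f i; f j] p, [set f i; f j] q & edge N p q] >] = true.
    apply: Qhom; split; last exact: card_set2.
    by move=> _ [->|->].
  move=> /asboolP[p [q [[->|->] [->|->] pq]]]; [|by left|by right|].
    by case: pq; rewrite ltxx.
  by case: pq; rewrite ltxx.
have tri p q r : edge N p q -> edge N q r -> edge N p r -> False.
  by move=> [_ pq] [qr1 qr] [_ pr]; apply: (Ntri _ _ _ _ _ qr1 pq pr).
have cyc p q r : edge N p q -> edge N q r -> edge N r p -> False.
  by move=> [pq _] [qr _] [rp _]; have := lt_trans pq (lt_trans qr rp); rewrite ltxx.
pose i0 : 'I_3 := ord0; pose i2 : 'I_3 := ord_max; pose i1 : 'I_3 := inord 1.
have i1E : val i1 = 1%N by rewrite /= inordK.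
have n01 : i0 != i1 by rewrite -val_eqE i1E.
have n12 : i1 != i2 by rewrite -val_eqE i1E.
have [] := (adj i0 i1 n01, adj i1 i2 n12, adj i0 i2 isT).
(* Each of the eight orientations contradicts [tri] or [cyc]. *)
move=> [[e01|e10] [e12|e21]] [e02|e20]; eauto.
Qed.

Hypothesis Kreg : infinite_regular_cardinal K.
Hypothesis Lsucc : successor_cardinal K L.
Hypothesis Lunb : is_unbounding_number K L.

(** By regularity of lambda, each of the kappa copies of lambda sends lambda points into a single
    column [c i]. Two copies cannot share that column, as the earlier one is already unbounded in
    it. *)
Lemma large_columns (Q : set (ord_mul L K)) : has_order_type Q (ord_mul L K) ->
  ~ small K [set c : K | [set: L] #<= [set b : L | Q (c, b)]].
Proof.
move=> [e [eQ _ _] emono].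
have elt : {mono e : x y / x < y} := leW_mono emono.
have einj := inc_inj emono.
have /choice[c cP] (i : K) : exists c : K, [set: L] #<= [set b : L | (e (i, b)).1 = c].
  apply: contrapT => nc.
  have /choice[g gP] c : exists a, forall b : L, (e (i, b)).1 = c -> b < a.
    apply: contrapT => na; apply: nc; exists c.
    apply: (unbounded_card_ge Kreg Lsucc Lunb) => a; apply: contrapT => nb.
    apply: na; exists a => b ebc; rewrite ltNge.
    by apply/negP => ab; apply: nb; exists b.
  (* With a bound above all columns' bounds, the image of (i, d) would fit in no column. *)
  have [d dP] := bounded_of_card_le Kreg Lsucc Lunb g.
  by have := lt_trans (gP _ d erefl) (dP _); rewrite ltxx.
pose D i := (fun b : L => (e (i, b)).2) @` [set b : L | (e (i, b)).1 = c i].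
have LD i : [set: L] #<= D i.
  apply: (card_le_trans (cP i)); apply: (@set_inj_card_le _ _ (fun b : L => (e (i, b)).2)).
    move=> b b' /set_mem /= eb /set_mem /= eb' ebb'.
    suff [] : (i, b) = (i, b') by [].
    by apply: einj; rewrite [LHS]surjective_pairing [RHS]surjective_pairing eb eb' ebb'.
  by move=> b eb; exists b.
apply; apply: (@set_inj_card_le _ _ c) => [i j _ _ cij|i _ /=].
  suff lt_ij i' j' : i' < j' -> c i' = c j' -> False.
    by case: (ltgtP i j) => // ij; case: (lt_ij _ _ ij).
  move=> {cij}ij cij.
  have [l0 _] : exists l0 : L, True.
    by have [_ [/card_leT_inj[h _ _] _] _] := Lsucc; exists (h i).
  have [_ [b0 eb0 _] _] := card_ge_unbounded Kreg Lsucc Lunb l0 (LD j').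
  (* A point of the earlier copy placed above a point of the later one, in their common column. *)
  have [_ [b eb <-] yb] := card_ge_unbounded Kreg Lsucc Lunb (e (j', b0)).2 (LD i').
  have : ((i', b) : ord_mul L K) < (j', b0).
    by rewrite ltxi_pair (ltW ij) /= leNgt ij.
  rewrite -elt [e (i', b)]surjective_pairing [e (j', b0)]surjective_pairing.
  rewrite eb eb0 cij ltxi_pair lexx /=.
  by rewrite ltNge (ltW yb).
apply: (card_le_trans (LD i)); apply: subset_card_le => _ [b eb <-] /=.
by rewrite -eb -surjective_pairing; apply: eQ.
Qed.

Lemma edge_of_large_columns (code : L -> L -> K) (v : L -> K -> K) (x : L -> set L)
    (N : L -> K -> set L) (Q : set (K * L)) :
  (forall g, exists e, ~ small K [set i | g i <= v e i]) ->
  (forall a, [set: K] #= x a) ->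
  (forall C, [set: L] #<= C -> exists a, x a `<=` C) ->
  (forall a c g, task code v a c g -> x g `<=` [set b | b < a] ->
     exists2 b, N a c b & x g b) ->
  ~ small K [set c | [set: L] #<= [set b | Q (c, b)]] ->
  exists p q, [/\ Q p, Q q & edge N p q].
Proof.
move=> vunb xK xstick Nhit Qlarge; have Qcof := not_small_cofinal Kreg Qlarge.
have /choice[n nP] c : exists c', c <= c' /\ [set: L] #<= [set b | Q (c', b)].
  by have [c' Qc' cc'] := Qcof c; exists c'.
have /choice[g gP] c : exists a, x a `<=` [set b | Q (n c, b)].
  by apply: xstick; exact: (nP c).2.
have [d gd] := bounded_of_card_le Kreg Lsucc Lunb g.
have [e ve] := vunb (code d \o g).
have /choice[s sP] c : exists s, forall b, x (g c) b -> b < s.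
  exact: (bounded_of_card_eq Kreg Lsucc Lunb (xK _)).
have [t st] := bounded_of_card_le Kreg Lsucc Lunb s.
have /infinite_setN0[k0 _] := Kreg.1.2.
(* Above [t], the point [a] exceeds every chosen stick set; above [d] and [e], it assigns them codes
   injectively. *)
have [a Qa] := card_ge_unbounded Kreg Lsucc Lunb (Order.max t (Order.max d e)) (nP k0).2.
rewrite !gt_max => /and3P[ta da ea].
(* From [k] on, columns come after that of [a], and [d] and [e] count as early for [a]. *)
have [k] := exists_gt Kreg (Order.max (n k0) (Order.max (code a d) (code a e))).
rewrite !gt_max => /and3P[nk dk ek].
have [c /= gc kc] := not_small_cofinal Kreg ve k.
have knc := le_trans kc (nP c).1.
have [||b Nb xb] := Nhit a (n c) (g c).
- exists d; first by split=> //; exact: lt_le_trans knc.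
  exists e; first by split=> //; exact: lt_le_trans knc.
  (* The column [n c] may lie beyond the index [c] where [v e] is large; the range c' <= c in [task]
     absorbs this. *)
  by exists c; [exact: (nP c).1|split=> //; exact: gd].
- by move=> b /sP bs /=; exact: lt_trans bs (lt_trans (st c) ta).
exists (n k0, a), (n c, b); split; [exact: Qa|exact: gP|].
by split=> //=; exact: lt_le_trans knc.
Qed.

End Coloring.

Theorem theorem4p2 (dK dL : Order.disp_t) (K : orderType dK) (L : orderType dL)
    (kappa_regular : infinite_regular_cardinal K)
    (lambda_succ : successor_cardinal K L)
    (lambda_unbounding : is_unbounding_number K L)
    (lambda_stick : is_stick K L) :
  ~ arrows (ord_mul L K) (ord_mul L K) 3.
Proof.
have Lwf : well_founded (fun a b : L => a < b).
  by have [[wo _] _ _] := lambda_succ; exact: well_order_lt_wf.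
have /choice[code code_inj] := segment_injection kappa_regular lambda_succ.
have [v vunb] := unbounded_sequence lambda_unbounding.
have [x [xK xstick]] := stick_sequence lambda_succ lambda_stick.
have [N [Ntri Nhit]] := sparse_family kappa_regular Lwf v code_inj xK.
have idtype : has_order_type [set: ord_mul L K] (ord_mul L K).
  by exists id => //; split=> // y _; exists y.
(* Edges are directed, so a pair gets colour 1 when it spans an edge in either direction. *)
move=> /(_ _ _ idtype (fun a => `[< exists p q, [/\ a p, a q & edge N p q] >])).
move=> [[Q Qtype Qhom]|[Q Q3 Qhom]]; last exact: no_homogeneous_triple Ntri (conj Q3 Qhom).
have [p [q [Qp Qq pq]]] := edge_of_large_columns kappa_regular lambda_succ
  lambda_unbounding vunb xK xstick Nhit
  (large_columns kappa_regular lambda_succ lambda_unbounding Qtype).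
have pq_neq : p <> q by move=> pqE; case: pq; rewrite pqE ltxx.
suff : `[< exists p' q', [/\ [set p; q] p', [set p; q] q' & edge N p' q'] >] = false.
  by move/asboolPn; apply; exists p, q; split; [left|right|].
by apply: Qhom; split; [move=> _ [->|->]|exact: card_set2].
Qed.
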